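(* Let $s$ be a binary string over $\{a,b\}$ of length $n$ whose run-length encoding has length $\rho$. There is an index for $s$ of size $O(\min(\rho^2,n))$, constructible from $s$ in $O(n+\rho^2\log\rho)$ time, with which any query of the Binary Jumbled String Matching problem for $s$ (given non-negative integers $x,y$, decide whether $s$ has a substring with exactly $x$ $a$'s and exactly $y$ $b$'s) can be answered in $O(\log\rho)$ time.
   Context: Every binary string $s$ over $\{a,b\}$ can be uniquely written as $s=a^{u_1}b^{v_1}a^{u_2}b^{v_2}\cdots a^{u_r}b^{v_r}$ with non-negative integers $u_i,v_i$, all non-zero except possibly $u_1$ and $v_r$; its run-length encoding is $\mathit{rle}(s)=(u_1,v_1,\ldots,u_r,v_r)$ and $\rho=|\mathit{rle}(s)|$ is the number of its non-zero entries (so $2r-2\le\rho\le 2r$). The size of the index is measured in number of entries, each being a pair of integers (fitting in two computer words). *)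

(* Defs.v *)
From mathcomp Require Import all_boot.

Set Implicit Arguments.
Unset Strict Implicit.
Unset Printing Implicit Defensive.

(* Plain MathComp.  A binary string is a [seq bool]; the letter a is [false],
   the letter b is [true]. *)

(** * Run-length encoding *)

(* The sequence of pairs (u_1, v_1), ..., (u_r, v_r), with r >= 1; the empty
   string has r = 1 and u_1 = v_1 = 0. *)
Definition is_rle (s : seq bool) (uv : seq (nat * nat)) : Prop :=
  [/\ 0 < size uv,
      s = flatten [seq nseq p.1 false ++ nseq p.2 true | p <- uv],
      forall i, 0 < i < size uv -> (nth (0, 0) uv i).1 != 0
    & forall i, i.+1 < size uv -> (nth (0, 0) uv i).2 != 0].

Fixpoint rle (s : seq bool) : seq (nat * nat) :=
  if s is c :: s' then
    match rle s' with
    | [::] => [::]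
    | (u, v) :: l =>
        if c == false then (u.+1, v) :: l
        else if u == 0 then (0, v.+1) :: l else [:: (0, 1), (u, v) & l]
    end
  else [:: (0, 0)].

Definition rho (s : seq bool) : nat :=
  count (fun k => k != 0) (flatten [seq [:: p.1; p.2] | p <- rle s]).

Lemma rle_is_rle s : is_rle s (rle s).
Proof.
elim: s => [|c s [+ IHs IHu IHv]] /=; first by split=> // -[|[]].
case: (rle s) IHs IHu IHv => [//|[u v] l] /= IHs IHu IHv _.
case: c => /=; last first.
  split=> //=; first by rewrite IHs.
  - by move=> [//|i] /IHu.
  - by move=> [|i] /IHv.
case: eqP => [u0|/eqP u0].
  split=> //=; first by rewrite IHs u0.
  - by move=> [//|i] /IHu.
  - by move=> [//|i] /IHv.
split=> //=; first by rewrite IHs.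
- by move=> [//|[//|i]] /= /(IHu i.+1).
- by move=> [//|i] /= /(IHv i).
Qed.

Lemma is_rle_uniq s uv : is_rle s uv -> uv = rle s.
Proof.
elim: s uv => [|c s IHs] uv [].
  case: uv => [|[[|u] [|v]] [|p l]] //= _ _ _ /(_ 0 isT) //.
case: uv => [|[[|u] v] l] //= _; last first.
  move=> [-> def_s] hu hv; rewrite -(IHs ((u, v) :: l)) //; split=> //.
    by move=> [//|i] /hu.
  by move=> [|i] /hv.
case: v => [|[|v]] /=.
- by case: l => [//|p l] _ _ /(_ 0 isT).
- case: l => [|[u v] l] [-> def_s] hu hv.
    by rewrite -(IHs [:: (0, 0)]) //; split=> // -[|].
  have /= u_gt0 := hu 1 isT.
  rewrite -(IHs ((u, v) :: l)) /= ?(negbTE u_gt0) //; split=> //.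
    by move=> [//|i] /(hu i.+2).
  by move=> i /(hv i.+1).
move=> [-> def_s] hu hv; rewrite -(IHs ((0, v.+1) :: l)) //; split=> //.
  by move=> [//|i] /hu.
by move=> [//|i] /hv.
Qed.

(** * Jumbled matching *)

Definition jumbled_match (s : seq bool) (x y : nat) : Prop :=
  exists t : seq bool, [/\ infix t s, count_mem false t = x & count_mem true t = y].

(** * Word RAM

   A program is a fixed piece of syntax, independent of the input and of the
   word size [w].  Registers and memory cells hold words, i.e. naturals below
   2 ^ w; results that do not fit are reduced modulo 2 ^ w (subtraction is
   truncated at 0, division by 0 yields 0).  Every operator, register access,
   literal, memory access, assignment and branching test costs one step. *)

Inductive binop := OpAdd | OpSub | OpMul | OpDiv | OpLt | OpEq.

Inductive expr :=
| Lit of nat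
| Reg of nat
| Mem of expr
| Bin of binop & expr & expr.

Inductive cmd :=
| Skip
| Assign of nat & expr
| Store of expr & expr
| Seq of cmd & cmd
| If of expr & cmd & cmd
| While of expr & cmd.

Record state := State { regs : nat -> nat; cells : nat -> nat }.

Definition upd (f : nat -> nat) (i v : nat) : nat -> nat :=
  fun j => if j == i then v else f j.

Definition binop_sem (o : binop) (m n : nat) : nat :=
  match o with
  | OpAdd => m + n
  | OpSub => m - n
  | OpMul => m * n
  | OpDiv => m %/ n
  | OpLt => m < n
  | OpEq => m == n
  end.

Fixpoint eval (w : nat) (st : state) (e : expr) : nat :=
  match e with
  | Lit k => k %% 2 ^ w
  | Reg r => regs st r
  | Mem e1 => cells st (eval w st e1)
  | Bin o e1 e2 => binop_sem o (eval w st e1) (eval w st e2) %% 2 ^ w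
  end.

Fixpoint ecost (e : expr) : nat :=
  match e with
  | Lit _ | Reg _ => 1
  | Mem e1 => (ecost e1).+1
  | Bin _ e1 e2 => (ecost e1 + ecost e2).+1
  end.

(* [exec w c st t st']: with [w]-bit words, [c] started in [st] halts in [st']
   after exactly [t] steps. *)
Inductive exec (w : nat) : cmd -> state -> nat -> state -> Prop :=
| exec_skip st : exec w Skip st 1 st
| exec_assign st r e :
    exec w (Assign r e) st (ecost e).+1
      (State (upd (regs st) r (eval w st e)) (cells st))
| exec_store st e1 e2 :
    exec w (Store e1 e2) st (ecost e1 + ecost e2).+1
      (State (regs st) (upd (cells st) (eval w st e1) (eval w st e2)))
| exec_seq c1 c2 st t1 st1 t2 st2 :
    exec w c1 st t1 st1 -> exec w c2 st1 t2 st2 ->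
    exec w (Seq c1 c2) st (t1 + t2) st2
| exec_if e c1 c2 st t st1 :
    exec w (if eval w st e != 0 then c1 else c2) st t st1 ->
    exec w (If e c1 c2) st ((ecost e).+1 + t) st1
| exec_while_false e c st :
    eval w st e = 0 -> exec w (While e c) st (ecost e).+1 st
| exec_while_true e c st t1 st1 t2 st2 :
    eval w st e != 0 ->
    exec w c st t1 st1 -> exec w (While e c) st1 t2 st2 ->
    exec w (While e c) st ((ecost e).+1 + t1 + t2) st2.

Lemma exec_det w c st t1 st1 t2 st2 :
  exec w c st t1 st1 -> exec w c st t2 st2 -> t1 = t2 /\ st1 = st2.
Proof.
move=> run; elim: run t2 st2 => {c st t1 st1}.
- by move=> st t2 st2 run; inversion run.
- by move=> st r e t2 st2 run; inversion run.
- by move=> st e1 e2 t2 st2 run; inversion run.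
- move=> c1 c2 st t st1 t' st1' _ IH1 _ IH2 t2 st2 run; inversion run; subst.
  match goal with H : exec w c1 _ _ _ |- _ => case: (IH1 _ _ H) => ? ? end.
  subst.
  by match goal with H : exec w c2 _ _ _ |- _ => case: (IH2 _ _ H) => -> -> end.
- move=> e c1 c2 st t st1 _ IH t2 st2 run; inversion run; subst.
  by match goal with H : exec w (if _ then _ else _) _ _ _ |- _ =>
       case: (IH _ _ H) => -> -> end.
- move=> e c st e0 t2 st2 run; inversion run; subst => //.
  by match goal with H : is_true (eval w st e != 0) |- _ =>
       rewrite e0 in H end.
- move=> e c st t st1 t' st1' e1 _ IH1 _ IH2 t2 st2 run; inversion run; subst.
    by match goal with H : eval w _ e = 0 |- _ => rewrite H in e1 end.
  match goal with H : exec w c _ _ _ |- _ => case: (IH1 _ _ H) => ? ? end.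
  subst.
  by match goal with H : exec w (While e c) _ _ _ |- _ =>
       case: (IH2 _ _ H) => -> -> end.
Qed.

(* The registers 0, 1, 2, ... hold [args], the cells 0, 1, 2, ... hold
   [contents], and everything else is 0. *)
Definition init (args contents : seq nat) : state :=
  State (nth 0 args) (nth 0 contents).

(** * Indices *)

(* An index is a sequence of entries; in memory an entry takes two consecutive
   words. *)
Definition words (idx : seq (nat * nat)) : seq nat :=
  flatten [seq [:: p.1; p.2] | p <- idx].

(* Within [T] steps, [build], started with the letters of [s] one per cell
   (a as 0, b as 1) and |s| in register 0, halts with the number of entries of
   [idx] in register 0 and the address of its first word in register 1. *)
Definition builds (w : nat) (build : cmd) (s : seq bool)
    (idx : seq (nat * nat)) (T : nat) : Prop :=
  exists t st,
    [/\ exec w build (init [:: size s] (map nat_of_bool s)) t st,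
        t <= T,
        regs st 0 = size idx
      & forall i, i < size (words idx) ->
          cells st (regs st 1 + i) = nth 0 (words idx) i].

(* Within [T] steps, [query], started on a memory that contains nothing but
   [idx], with the number of its entries, [x] and [y] in registers 0, 1 and 2,
   halts with a truth value for [ans] in register 0. *)
Definition answers (w : nat) (query : cmd) (idx : seq (nat * nat))
    (x y : nat) (ans : Prop) (T : nat) : Prop :=
  exists t st,
    [/\ exec w query (init [:: size idx; x; y] (words idx)) t st,
        t <= T
      & (regs st 0 != 0) <-> ans].

(* Main.v *)
From Stdlib Require Import FunctionalExtensionality.
Require Import Defs.
From mathcomp Require Import all_boot.
From mathcomp Require Import zify.

Set Implicit Arguments.
Unset Strict Implicit.
Unset Printing Implicit Defensive.

(* Rounding the ends of a substring to run boundaries (cuts) can be done so that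
   it keeps at least as many b's and at most as many a's, or the other way
   round.  So, V being the set of Parikh vectors (A, B) of the substrings
   between two cuts, the numbers of b's of the substrings with x a's lie between low x,
   the least B with A >= x, and high x, the greatest B with A <= x; sliding a
   window of length x + y shows that every y in between occurs.  Both functions
   are constant except at O(rho^2) breakpoints, each of the form A or A + 1, and
   the index lists their values there; a query is a binary search.  No sorting
   is needed to build it: the vectors are entered in two tables indexed by A,
   of which one takes running maxima.  An index is thus found in time
   O(n + rho^2). *)

(** * Jumbled matching by run boundaries *)

(** An empty maximum is 0, so only a strict lower bound is sure to yield a witness. *)
Lemma bigmax_gtP (V : seq (nat * nat)) (P : pred (nat * nat))
    (F : nat * nat -> nat) k :
  reflect (exists2 v, v \in V & P v /\ k < F v) (k < \max_(v <- V | P v) F v).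
Proof.
apply: (iffP idP) => [|[v vV [Pv kF]]].
  elim: V => [|v V IH]; first by rewrite big_nil.
  rewrite big_cons; case: ifP => [Pv|_ /IH[u uV ?]]; last first.
    by exists u; rewrite // inE uV orbT.
  rewrite leq_max => /orP[kF|/IH[u uV ?]]; first by exists v; rewrite ?mem_head.
  by exists u; rewrite // inE uV orbT.
by apply: leq_trans kF _; apply: leq_bigmax_seq.
Qed.

(** Appending to a list thus has the shape of [upd] on the memory cells that store it. *)
Lemma nth_rcons_upd (T : Type) (x0 v : T) l j :
  nth x0 (rcons l v) j = if j == size l then v else nth x0 l j.
Proof.
by rewrite nth_rcons; case: ltngtP => // ?; rewrite [RHS]nth_default // ltnW.
Qed.

Lemma bigmax_split (T : Type) (V : seq T) (P Q R : pred T) (F : T -> nat) :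
    P =1 predU Q R ->
  \max_(v <- V | P v) F v
    = maxn (\max_(v <- V | Q v) F v) (\max_(v <- V | R v) F v).
Proof.
move=> PQR; elim: V => [|v V IH]; first by rewrite !big_nil.
by rewrite !big_cons IH PQR /=; case: (Q v); case: (R v) => /=; lia.
Qed.

(** * Prefix counts and cuts *)

Definition cnt (c : bool) (s : seq bool) (i : nat) := count_mem c (take i s).

(** The default 2 differs from both letters, so the last position of [s] always ends a run; it is
    also the sentinel stored behind [s] in memory. *)
Definition letter (s : seq bool) (i : nat) : nat := nth 2 (map nat_of_bool s) i.

Definition run_end (s : seq bool) (i : nat) : bool := letter s i != letter s i.+1.

(** [i] bounds the scanned positions, so that the list grows with the scan of [s]; the cuts of [s]
    itself are those for [i = size s]. *)
Definition cuts (s : seq bool) (i : nat) : seq nat :=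
  0 :: [seq j.+1 | j <- iota 0 i & run_end s j].

Lemma cntS c s i : i < size s -> cnt c s i.+1 = cnt c s i + (letter s i == c).
Proof.
move=> lt_i; rewrite /cnt (take_nth true) // -cats1 count_cat /= addn0.
by rewrite /letter (nth_map true) //; case: (nth _ _ _); case: c.
Qed.

Lemma leq_cnt c s i j : i <= j -> cnt c s i <= cnt c s j.
Proof.
move=> le_ij; rewrite /cnt -(cat_take_drop i (take j s)) take_takel //.
by rewrite count_cat leq_addr.
Qed.

Lemma cnt_sum s i : i <= size s -> cnt false s i + cnt true s i = i.
Proof.
elim: i => [|i IH] lt_i; first by rewrite /cnt take0.
move: (IH (ltnW lt_i)); rewrite !cntS //.
by rewrite /letter (nth_map true) //; case: (nth _ _ _) => /=; lia.
Qed.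

(** By induction: a letter put in front of a non-empty string adds a run end exactly when it differs
    from the first letter, and then it adds a non-zero entry to [rle]. *)
Lemma count_run_end s : count (run_end s) (iota 0 (size s)) = rho s.
Proof.
elim: s => [//|c s IHs]; rewrite [iota _ _]/= [LHS]/= (iotaDl 1 0) count_map.
rewrite (eq_count (a2 := run_end s)) // IHs.
case: s IHs => [|d s] _; first by case: c.
rewrite {1}/run_end /letter /rho /=; case: (rle_is_rle s).
case: (rle s) => [//|[u v] l] _ _ _ _.
by case: c; case: d => //=; case: u => [|u] /=; rewrite ?add0n ?add1n.
Qed.

Lemma size_cuts s : size (cuts s (size s)) = (rho s).+1.
Proof. by rewrite /= size_map size_filter count_run_end. Qed.

Lemma mem_cutsS s i : i < size s -> run_end s i -> i.+1 \in cuts s (size s).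
Proof.
by move=> lt_i ei; rewrite inE map_f // mem_filter ei mem_iota.
Qed.

Lemma cutsW s i : i \in cuts s (size s) -> i <= size s.
Proof.
rewrite inE => /orP[/eqP->//|/mapP[j]].
by rewrite mem_filter mem_iota => /andP[_ ?] ->.
Qed.

Lemma run_end_last s i : i.+1 = size s -> run_end s i.
Proof.
move=> def_i; rewrite /run_end /letter (nth_map true) ?def_i //.
by rewrite (@nth_default _ _ _ (size s)) ?size_map //; case: nth.
Qed.

(* Inside a run of [c] move right to its end, inside a run of [~~ c] move left
   to its start. *)
Lemma round_to_cut c s i : i <= size s ->
  exists p, [/\ p \in cuts s (size s), cnt c s i <= cnt c s p
              & cnt (~~ c) s p <= cnt (~~ c) s i].
Proof.
have left j : j < size s -> letter s j != c ->
    exists p, [/\ p \in cuts s (size s), cnt c s j <= cnt c s p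
              & cnt (~~ c) s p <= cnt (~~ c) s j].
  elim: j => [|j IH] lt_j nj; first by exists 0; rewrite mem_head.
  have [ej|nej] := eqVneq (letter s j) c.
    exists j.+1; split=> //; apply: mem_cutsS; first exact: ltnW.
    by rewrite /run_end ej eq_sym.
  have [p [pC cp ncp]] := IH (ltnW lt_j) nej.
  exists p; split=> //; first by rewrite cntS ?(negbTE nej) ?addn0 // ltnW.
  exact: leq_trans ncp (leq_cnt _ _ (leqnSn j)).
move=> le_i; move def_k: (size s - i) => k.
elim: k i le_i def_k => [|k IH] i le_i def_k.
  have -> : i = size s by lia.
  exists (size s); split=> //; case def_n: (size s) => [|n].
    by rewrite mem_head.
  by rewrite -def_n {1}def_n mem_cutsS ?run_end_last ?def_n.
have lt_i : i < size s by lia.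
have [ei|] := eqVneq (letter s i) c; last exact: left.
have [||p [pC cp ncp]] := IH i.+1; [lia | lia|].
exists p; split=> //; first exact: leq_trans (leq_cnt _ _ (leqnSn i)) cp.
by move: ncp; rewrite cntS // ei; case: c {left IH ei cp} => /=; rewrite addn0.
Qed.

(** * Parikh vectors between cuts *)

Definition pts (s : seq bool) (i : nat) : seq (nat * nat) :=
  [seq (cnt false s j, cnt true s j) | j <- cuts s i].

(** [t] encodes an ordered pair of cuts in base [rho s + 1]. If the second cut precedes the first,
    truncated subtraction gives (0, 0), the vector of an empty substring, so such pairs do no
    harm. *)
Definition vec (s : seq bool) (t : nat) : nat * nat :=
  let p := nth (0, 0) (pts s (size s)) (t %/ (rho s).+1) in
  let q := nth (0, 0) (pts s (size s)) (t %% (rho s).+1) in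
  (q.1 - p.1, q.2 - p.2).

Definition vecs (s : seq bool) : nat -> seq (nat * nat) := mkseq (vec s).

Definition all_vecs (s : seq bool) := vecs s ((rho s).+1 * (rho s).+1).

Lemma size_pts s : size (pts s (size s)) = (rho s).+1.
Proof. by rewrite size_map size_cuts. Qed.

Lemma mem_all_vecs s v :
  (exists p q, [/\ p \in cuts s (size s), q \in cuts s (size s) &
     v = (cnt false s q - cnt false s p, cnt true s q - cnt true s p)])
  <-> v \in all_vecs s.
Proof.
have szC := size_cuts s.
split=> [[p [q [pC qC ->]]]|/mapP[t]].
  apply/mapP; exists (index p (cuts s (size s)) * (rho s).+1
                       + index q (cuts s (size s))).
    move: pC qC; rewrite mem_iota -!index_mem szC; nia.
  have ltq : index q (cuts s (size s)) < (rho s).+1 by rewrite -szC index_mem.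
  rewrite /vec divnMDl // modnMDl divn_small // modn_small // addn0.
  by rewrite /pts !(nth_map 0) ?nth_index ?index_mem.
rewrite mem_iota => /andP[_ lt_t] ->.
exists (nth 0 (cuts s (size s)) (t %/ (rho s).+1)).
exists (nth 0 (cuts s (size s)) (t %% (rho s).+1)).
have ltd : t %/ (rho s).+1 < size (cuts s (size s)) by rewrite szC ltn_divLR.
have ltm : t %% (rho s).+1 < size (cuts s (size s)) by rewrite szC ltn_mod.
by rewrite !mem_nth // /vec /pts !(nth_map 0).
Qed.

(* The minimum of the [v.2], written as a maximum so that it is n + 1, more than
   any [high], when [x] exceeds the number of a's. *)
Definition low (s : seq bool) (x : nat) : nat :=
  (size s).+1 - \max_(v <- all_vecs s | x <= v.1) ((size s).+1 - v.2).

Definition high (s : seq bool) (x : nat) : nat :=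
  \max_(v <- all_vecs s | v.1 <= x) v.2.

Lemma jumbled_match_cnt s x y : jumbled_match s x y <->
  exists i j, [/\ i <= j <= size s, x = cnt false s j - cnt false s i
                & y = cnt true s j - cnt true s i].
Proof.
split=> [[t [/infixP[p [q ->]] <- <-]]|[i [j [/andP[le_ij le_j] -> ->]]]].
  exists (size p), (size p + size t); rewrite !size_cat !leq_add2l !leq_addr.
  split=> //; rewrite /cnt takeD drop_size_cat // !take_size_cat //;
    by rewrite count_cat addKn.
exists (drop i (take j s)); split.
- apply/infixP; exists (take i s), (drop j s).
  by rewrite -{1}(take_takel _ le_ij) catA !cat_take_drop.
- by rewrite /cnt -{2}(cat_take_drop i (take j s)) take_takel // count_cat addKn.
- by rewrite /cnt -{2}(cat_take_drop i (take j s)) take_takel // count_cat addKn.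
Qed.

(** Discrete intermediate value theorem; the disjunction lets the end values come in either
    order. *)
Lemma nat_ivt (f : nat -> nat) m k x :
    (forall i, i < m + k -> f i.+1 <= (f i).+1 /\ f i <= (f i.+1).+1) ->
    (f m <= x <= f (m + k)) || (f (m + k) <= x <= f m) ->
  exists2 i, i <= m + k & f i = x.
Proof.
elim: k => [|k IH] near; first by rewrite addn0; exists m; lia.
have [|e] := eqVneq (f (m + k.+1)) x; first by exists (m + k.+1).
move=> btw; have [||i] := IH.
- by move=> i lt_i; apply: near; lia.
- by have := near (m + k); rewrite -addnS; lia.
by exists i => //; lia.
Qed.

(* All windows below have length [x + y]: a substring with too few a's and
   enough b's yields such a window with at most [x] a's, whichever of the two
   is the longer; symmetrically for the other one. *)
Lemma between_match s x y i j i' j' :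
    i <= j <= size s -> i' <= j' <= size s ->
    cnt false s j - cnt false s i <= x -> y <= cnt true s j - cnt true s i ->
    x <= cnt false s j' - cnt false s i' -> cnt true s j' - cnt true s i' <= y ->
  jumbled_match s x y.
Proof.
move=> le_ij le_ij' Ax yB xA By.
(* Keep the left end [k] if a window of length [x + y] fits there, and take the last such window of
   [s] otherwise. *)
have window k l : k <= l <= size s -> x + y <= size s ->
    exists2 p, p + (x + y) <= size s &
      (k <= p /\ p + (x + y) <= l) \/ (p <= k /\ l <= p + (x + y)).
  move=> le_kl le_n; have [?|?] := leqP (x + y) (l - k); first by exists k; lia.
  by have [?|?] := leqP (k + (x + y)) (size s);
    [exists k; lia | exists (size s - (x + y)); lia].
have le_n : x + y <= size s.
  have := @leq_cnt true s j (size s); have := @leq_cnt false s j' (size s).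
  by have := cnt_sum (leqnn (size s)); lia.
have [p le_p np] := window _ _ le_ij le_n.
have [q le_q nq] := window _ _ le_ij' le_n.
pose f k := cnt false s (k + (x + y)) - cnt false s k.
have mono c k l : k <= l -> cnt c s k <= cnt c s l by exact: leq_cnt.
(* A window inside the substring from [i] to [j] has no more a's than it; a window around it has at
   least [y] b's, which leaves room for at most [x] a's. *)
have fp : f p <= x.
  have := mono true _ _ (proj1 (andP le_ij)).
  rewrite /f; have := cnt_sum le_p; have := @cnt_sum s p.
  case: np => -[/[dup] /(mono false) ? /(mono true) ?].
    by move=> /[dup] /(mono false) ? /(mono true) ?; lia.
  by move=> /[dup] /(mono false) ? /(mono true) ?; lia.
have fq : x <= f q.
  have := mono false _ _ (proj1 (andP le_ij')).
  rewrite /f; have := cnt_sum le_q; have := @cnt_sum s q.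
  case: nq => -[/[dup] /(mono false) ? /(mono true) ?].
    by move=> /[dup] /(mono false) ? /(mono true) ?; lia.
  by move=> /[dup] /(mono false) ? /(mono true) ?; lia.
(* Sliding by one position loses one letter and gains one. *)
have near k : k + (x + y) < size s -> f k.+1 <= (f k).+1 /\ f k <= (f k.+1).+1.
  move=> lt_k; rewrite /f addSn !cntS; [|lia|lia].
  have := mono false k (k + (x + y)).
  by case: (_ == _); case: (_ == _) => /=; lia.
have [k le_k fk] : exists2 k, k + (x + y) <= size s & f k = x.
  case: (leqP p q) => lt_pq.
    have [||k le_k fk] := @nat_ivt f p (q - p) x.
    - by move=> k lt_k; apply: near; lia.
    - by rewrite subnKC //; lia.
    by exists k => //; lia.
  have [||k le_k fk] := @nat_ivt f q (p - q) x.
  - by move=> k lt_k; apply: near; lia.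
  - by rewrite subnKC ?(ltnW lt_pq) //; lia.
  by exists k => //; lia.
rewrite /f in fk; apply/jumbled_match_cnt; exists k, (k + (x + y)).
split; [lia | by [] |]; have := cnt_sum le_k; have := @cnt_sum s k.
by have := mono false k (k + (x + y)); have := mono true k (k + (x + y)); lia.
Qed.

Lemma vec_match s (v : nat * nat) : v \in all_vecs s ->
  exists i j, [/\ i <= j <= size s,
  v.1 = cnt false s j - cnt false s i & v.2 = cnt true s j - cnt true s i].
Proof.
move=> /mem_all_vecs[p [q [/cutsW pC /cutsW qC ->]]] /=.
have [le_pq|/ltnW le_qp] := leqP p q; first by exists p, q; rewrite le_pq.
exists p, p; rewrite leqnn pC; split=> //.
  by have := @leq_cnt false s _ _ le_qp; lia.
by have := @leq_cnt true s _ _ le_qp; lia.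
Qed.

Lemma jumbled_matchE s x y : jumbled_match s x y <-> low s x <= y <= high s x.
Proof.
split.
  move=> /jumbled_match_cnt[i [j [/andP[le_ij le_j] -> ->]]].
  have le_i := leq_trans le_ij le_j.
  (* Moving the start towards more a's and the end towards more b's gives [v1], with at most as many
     a's and at least as many b's; the opposite choices give [v2]. They are the witnesses for [high]
     and [low]. *)
  have [p [pC]] := @round_to_cut false s i le_i.
  have [q [qC]] := @round_to_cut true s j le_j.
  have [p' [pC']] := @round_to_cut true s i le_i.
  have [q' [qC']] := @round_to_cut false s j le_j.
  move=> /= a1 b1 a2 b2 a3 b3 a4 b4.
  have v1 : (cnt false s q - cnt false s p, cnt true s q - cnt true s p)
      \in all_vecs s by apply/mem_all_vecs; exists p, q.
  have v2 : (cnt false s q' - cnt false s p', cnt true s q' - cnt true s p')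
      \in all_vecs s by apply/mem_all_vecs; exists p', q'.
  apply/andP; split.
    apply: (@leq_trans (cnt true s q' - cnt true s p')); last lia.
    rewrite /low leq_subCl.
    apply: (@leq_bigmax_seq _ _ _ (fun v => (size s).+1 - v.2) _ v2).
    by rewrite /=; lia.
  apply: (@leq_trans (cnt true s q - cnt true s p)); first lia.
  by apply: (@leq_bigmax_seq _ _ _ snd _ v1); rewrite /=; lia.
move=> /andP[low_y y_high].
have [i [j [ij Ax yB]]] : exists i j, [/\ i <= j <= size s,
    cnt false s j - cnt false s i <= x & y <= cnt true s j - cnt true s i].
  case: y y_high {low_y} => [|y]; first by exists 0, 0; rewrite !subnn.
  by move=> /bigmax_gtP[v /vec_match[i [j [? -> ->]]] [? ?]]; exists i, j.
(* This excludes the value n + 1 of [low], so that the maximum below is positive and attained. *)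
have le_y : y <= size s.
  have := @leq_cnt true s j (size s).
  by have := cnt_sum (leqnn (size s)); lia.
have : size s - y < \max_(v <- all_vecs s | x <= v.1) ((size s).+1 - v.2).
  by rewrite /low in low_y; lia.
move=> /bigmax_gtP[v /vec_match[i' [j' [ij' e1 e2]]] /= [xA By]].
by apply: (between_match ij ij'); lia.
Qed.

(* The tables are filled for all pairs of cuts in the order of [vecs]; a cell
   never written is 0, which is neutral for the maximum. *)
Definition tab_high (V : seq (nat * nat)) (x : nat) : nat :=
  \max_(v <- V | v.1 == x) v.2.

Definition tab_low (n : nat) (V : seq (nat * nat)) (x : nat) : nat :=
  \max_(v <- V | v.1 == x) (n.+1 - v.2).

(** [low s x] is [(size s).+1 - suf_low s x]; suffix maxima can be computed in place, from right to
    left. *)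
Definition suf_low (s : seq bool) (x : nat) : nat :=
  \max_(v <- all_vecs s | x <= v.1) ((size s).+1 - v.2).

Lemma bigmax_vecsS s t (F : nat * nat -> nat) x :
  \max_(v <- vecs s t.+1 | v.1 == x) F v
    = maxn (\max_(v <- vecs s t | v.1 == x) F v)
           (if (vec s t).1 == x then F (vec s t) else 0).
Proof.
by rewrite /vecs mkseqS -cats1 big_cat /= big_cons big_nil maxn0.
Qed.

Lemma high0 s : high s 0 = tab_high (all_vecs s) 0.
Proof. by apply: eq_bigl => v; rewrite leqn0. Qed.

Lemma highS s x :
  high s x.+1 = maxn (high s x) (tab_high (all_vecs s) x.+1).
Proof. by apply: bigmax_split => v /=; lia. Qed.

Lemma suf_lowE s x :
  suf_low s x = maxn (tab_low (size s) (all_vecs s) x) (suf_low s x.+1).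
Proof. by apply: bigmax_split => v /=; lia. Qed.

Lemma vec_le s t : (vec s t).1 <= size s /\ (vec s t).2 <= size s.
Proof.
rewrite /vec /=; set q := nth _ _ (t %% _).
suff [? ?] : q.1 <= size s /\ q.2 <= size s.
  by split; apply: leq_trans (leq_subr _ _) _.
have lt_t : t %% (rho s).+1 < size (cuts s (size s)).
  by rewrite size_cuts ltn_mod.
rewrite /q /pts (nth_map 0) //=; set j := nth _ _ _.
have le_j : j <= size s by apply/cutsW/mem_nth.
by have := cnt_sum le_j; lia.
Qed.

Lemma all_vecs_le s (v : nat * nat) :
  v \in all_vecs s -> v.1 <= size s /\ v.2 <= size s.
Proof. by move=> /mapP[t _ ->]; apply: vec_le. Qed.

Lemma suf_low_out s x : size s < x -> suf_low s x = 0.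
Proof.
move=> lt_x; apply/eqP; rewrite -leqn0 leqNgt; apply/bigmax_gtP => -[v].
by move=> /all_vecs_le[+ _] [+ _]; lia.
Qed.

Lemma high_le s x : high s x <= size s.
Proof.
rewrite leqNgt; apply/bigmax_gtP => -[v /all_vecs_le[_ +] [_]].
by rewrite ltnNge => ->.
Qed.

(** * Breakpoints and the index *)

Definition prev_bounds (s : seq bool) (x : nat) : nat * nat :=
  if x is x'.+1 then (low s x', high s x') else ((size s).+2, 0).

Definition breakpoint (s : seq bool) (x : nat) : bool :=
  (low s x, high s x) != prev_bounds s x.

Definition breakpoints (s : seq bool) (x : nat) : seq nat :=
  [seq z <- iota 0 x | breakpoint s z].

(** Three numbers need two entries; the fourth word is padding, so the k-th breakpoint starts at
    word 4k. *)
Definition entries (s : seq bool) (z : nat) : seq (nat * nat) :=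
  [:: (z, low s z); (high s z, 0)].

(** The size bound is 0 for the empty string, which forces an empty index there. *)
Definition index_of (s : seq bool) : seq (nat * nat) :=
  if s == [::] then [::]
  else flatten [seq entries s z | z <- breakpoints s (size s).+2].

(** No value of [low] exceeds n + 1, hence the n + 2 in [prev_bounds]. The binary search therefore
    always has a leftmost breakpoint to start from. *)
Lemma breakpoint0 s : breakpoint s 0.
Proof. by rewrite /breakpoint xpair_eqE negb_and /low; apply/orP; left; lia. Qed.

(** From x to x + 1, [low] can change only if some vector has A = x, and [high] only if some vector
    has A = x + 1. *)
Lemma breakpoint_vec s x : breakpoint s x ->
  x \in 0 :: [seq v.1 | v <- all_vecs s] ++ [seq v.1.+1 | v <- all_vecs s].
Proof.
case: x => [|x]; first by rewrite mem_head.
rewrite /breakpoint xpair_eqE negb_and in_cons mem_cat.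
have tab_neq0 (F : nat * nat -> nat) z :
    0 < \max_(v <- all_vecs s | v.1 == z) F v -> exists2 v, v \in all_vecs s & v.1 = z.
  by move=> /bigmax_gtP[v vV [/eqP ? _]]; exists v.
case/orP => ne; apply/orP; right; apply/orP.
  right; have [|v vV <-] := @tab_neq0 (fun v => (size s).+1 - v.2) x.
    rewrite lt0n; apply: contra ne => /eqP t0.
    by rewrite /low -/(suf_low s x) suf_lowE /tab_low t0 max0n.
  by apply/mapP; exists v.
left; have [|v vV <-] := @tab_neq0 snd x.+1.
  by rewrite lt0n; apply: contra ne => /eqP t0; rewrite highS /tab_high t0 maxn0.
by apply/mapP; exists v.
Qed.

Lemma breakpoint_lt s x : breakpoint s x -> x < (size s).+2.
Proof.
move=> /breakpoint_vec; rewrite in_cons mem_cat => /or3P[/eqP->//||] /mapP[v].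
  by move=> /all_vecs_le[+ _] ->; lia.
by move=> /all_vecs_le[+ _] ->; lia.
Qed.

Lemma rho_gt0 (s : seq bool) : s != [::] -> 0 < rho s.
Proof.
move=> s0; rewrite -count_run_end -has_count; apply/hasP.
exists (size s).-1; last by rewrite run_end_last // prednK // lt0n size_eq0.
by rewrite mem_iota /=; case: s s0.
Qed.

Lemma rho_le s : rho s <= size s.
Proof. by rewrite -count_run_end -{2}(size_iota 0 (size s)) count_size. Qed.

Lemma size_breakpoints s x :
  size (breakpoints s x) <= minn x (1 + 2 * (rho s).+1 ^ 2).
Proof.
have le_x : size (breakpoints s x) <= x.
  by rewrite size_filter -{2}(size_iota 0 x) count_size.
rewrite leq_min le_x /=.
set V := 0 :: [seq v.1 | v <- all_vecs s] ++ [seq v.1.+1 | v <- all_vecs s].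
have -> : 1 + 2 * (rho s).+1 ^ 2 = size V.
  rewrite /V -cat1s !size_cat !size_map !size_iota.
  rewrite -mulnn /=; lia.
apply: uniq_leq_size; first by rewrite filter_uniq ?iota_uniq.
by move=> z; rewrite mem_filter => /andP[/breakpoint_vec].
Qed.

Lemma size_flatten_entries s zs :
  size (flatten [seq entries s z | z <- zs]) = 2 * size zs.
Proof. by elim: zs => //= z zs ->; lia. Qed.

Lemma size_index_of s : size (index_of s) <= 18 * minn (rho s ^ 2) (size s).
Proof.
rewrite /index_of; case: eqP => [//|/eqP s0]; rewrite size_flatten_entries.
(* For rho >= 1, 2 (1 + 2 (rho + 1)^2) <= 18 rho^2, with equality at rho = 1; similarly 2 (n + 2) <=
   6 n. *)
have := size_breakpoints s (size s).+2; have := rho_gt0 s0.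
have := rho_le s; rewrite !leq_min; nia.
Qed.

Lemma sorted_breakpoints s x : sorted ltn (breakpoints s x).
Proof. by apply: sorted_filter (iota_ltn_sorted 0 x); apply: ltn_trans. Qed.

Lemma nth_breakpoints_lt s x i j : i < j < size (breakpoints s x) ->
  nth 0 (breakpoints s x) i < nth 0 (breakpoints s x) j.
Proof.
move=> /andP[lt_ij lt_j].
apply: (sorted_ltn_nth ltn_trans 0 (sorted_breakpoints s x)) => //.
exact: ltn_trans lt_j.
Qed.

Lemma not_breakpointS s x : ~~ breakpoint s x.+1 ->
  low s x.+1 = low s x /\ high s x.+1 = high s x.
Proof. by rewrite negbK => /eqP[-> ->]. Qed.

Lemma bounds_nth_breakpoints s k x (zs := breakpoints s (size s).+2) :
    k < size zs -> nth 0 zs k <= x ->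
    (k.+1 < size zs -> x < nth 0 zs k.+1) ->
  low s x = low s (nth 0 zs k) /\ high s x = high s (nth 0 zs k).
Proof.
move=> lt_k; elim: x => [|x IH] le_x lt_x.
  by move: le_x; rewrite leqn0 => /eqP->.
have [<-//|ne_x] := eqVneq (nth 0 zs k) x.+1.
have [||<- <-] := IH; [by lia | by move=> /lt_x; lia|].
(* Were x + 1 a breakpoint, it would lie strictly between two consecutive members of the sorted list
   [zs], or beyond its last one. *)
apply: not_breakpointS; apply: contraNN (negbT (ltnn x)) => bx.
have lt_n := breakpoint_lt bx.
have x_zs : x.+1 \in zs by rewrite mem_filter bx mem_iota.
have lt_i : index x.+1 zs < size zs by rewrite index_mem.
have def_x := nth_index 0 x_zs.
have [lt_ik|lt_ki|def_i] := ltngtP (index x.+1 zs) k.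
- have := @nth_breakpoints_lt s (size s).+2 (index x.+1 zs) k; rewrite -/zs def_x; lia.
- have lt_k1 := leq_ltn_trans lt_ki lt_i; have := lt_x lt_k1.
  have [<-|ne_i] := eqVneq (index x.+1 zs) k.+1; first by rewrite def_x ltnn.
  have := @nth_breakpoints_lt s (size s).+2 k.+1 (index x.+1 zs).
  rewrite -/zs def_x; lia.
by rewrite -def_i def_x eqxx in ne_x.
Qed.

(** * Recurrences for the loop invariants *)

Lemma size_ptsS s i : size (pts s i) <= i.+1.
Proof.
rewrite size_map /= ltnS size_map size_filter -{2}(size_iota 0 i).
exact: count_size.
Qed.

Lemma cnt0 c s : cnt c s 0 = 0.
Proof. by rewrite /cnt take0. Qed.

Lemma pts0 s : pts s 0 = [:: (0, 0)].
Proof. by rewrite /pts /= /cnt take0. Qed.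

Lemma ptsS s i : pts s i.+1 = if run_end s i then
  rcons (pts s i) (cnt false s i.+1, cnt true s i.+1) else pts s i.
Proof.
rewrite /pts /cuts -addn1 iotaD filter_cat map_cat /= add0n addn1.
by case: ifP => _ /=; rewrite ?cats0 // map_cat cats1.
Qed.

Lemma vecs0 s : vecs s 0 = [::].
Proof. by []. Qed.

Lemma tab_highS s t x : tab_high (vecs s t.+1) x
  = maxn (tab_high (vecs s t) x) (if x == (vec s t).1 then (vec s t).2 else 0).
Proof. by rewrite /tab_high bigmax_vecsS eq_sym. Qed.

Lemma tab_lowS s t x : tab_low (size s) (vecs s t.+1) x
  = maxn (tab_low (size s) (vecs s t) x)
         (if x == (vec s t).1 then (size s).+1 - (vec s t).2 else 0).
Proof. by rewrite /tab_low bigmax_vecsS eq_sym. Qed.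

Lemma high_prev s x :
  high s x = maxn (prev_bounds s x).2 (tab_high (all_vecs s) x).
Proof. by case: x => [|x]; rewrite ?highS // high0 max0n. Qed.

Lemma low_le s x : low s x <= (size s).+1.
Proof. exact: leq_subr. Qed.

Lemma prev_bounds_le s x :
  (prev_bounds s x).1 <= (size s).+2 /\ (prev_bounds s x).2 <= size s.
Proof. by case: x => [|x] //=; rewrite high_le; have := low_le s x; lia. Qed.

Lemma nth0_breakpoints s x :
  nth 0 (breakpoints s x.+1) 0 = 0 /\ 0 < size (breakpoints s x.+1).
Proof. by rewrite /breakpoints /= breakpoint0. Qed.

Definition emitted (s : seq bool) (x : nat) : seq nat :=
  words (flatten [seq entries s z | z <- breakpoints s x]).

Lemma emitted0 s : emitted s 0 = [::].
Proof. by []. Qed.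

Lemma size_words l : size (words l) = 2 * size l.
Proof. by elim: l => //= p l IH; rewrite -/(words l) IH; lia. Qed.

Lemma size_emitted s x : size (emitted s x) = 4 * size (breakpoints s x).
Proof. by rewrite size_words size_flatten_entries mulnA. Qed.

Lemma breakpointsS s x : breakpoints s x.+1 =
  if breakpoint s x then rcons (breakpoints s x) x else breakpoints s x.
Proof.
rewrite /breakpoints -addn1 iotaD filter_cat /= add0n.
by case: ifP => _; rewrite ?cats0 ?cats1.
Qed.

Lemma emittedS s x : emitted s x.+1 =
  emitted s x ++ if breakpoint s x then [:: x; low s x; high s x; 0] else [::].
Proof.
rewrite /emitted breakpointsS; case: ifP => _; last by rewrite cats0.
by rewrite -cats1 map_cat flatten_cat /words map_cat flatten_cat.
Qed.

Lemma nth_words_entries s zs k : k < size zs ->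
  let ws := words (flatten [seq entries s z | z <- zs]) in
  [/\ nth 0 ws (4 * k) = nth 0 zs k,
      nth 0 ws (4 * k + 1) = low s (nth 0 zs k)
    & nth 0 ws (4 * k + 2) = high s (nth 0 zs k)].
Proof.
elim: zs k => [//|z zs IH] [_|k lt_k] //; have [e0 e1 e2] := IH k lt_k.
by have -> : 4 * k.+1 = (4 * k).+4 by lia.
Qed.

(* Keeps [/=] from unfolding these during symbolic execution. *)
Opaque pts cnt all_vecs vecs vec breakpoints.

(** * Reasoning about RAM programs *)

Definition runs (w : nat) (c : cmd) (st : state) (T : nat) (Q : state -> Prop) :=
  exists t st', [/\ exec w c st t st', t <= T & Q st'].

(** An upper bound only: both branches of a conditional are added, which keeps the bound linear. *)
Fixpoint cost (c : cmd) : nat :=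
  match c with
  | Skip => 1
  | Assign _ e => (ecost e).+1
  | Store e1 e2 => (ecost e1 + ecost e2).+1
  | Seq c1 c2 => cost c1 + cost c2
  | If e c1 c2 => (ecost e).+1 + (cost c1 + cost c2)
  | While _ _ => 0
  end.

(* Only for loop-free commands: loops get the junk values 0 above and [False]
   here. *)
Fixpoint wp (w : nat) (c : cmd) (Q : state -> Prop) (st : state) : Prop :=
  match c with
  | Skip => Q st
  | Assign i e => Q (State (upd (regs st) i (eval w st e)) (cells st))
  | Store e1 e2 =>
      Q (State (regs st) (upd (cells st) (eval w st e1) (eval w st e2)))
  | Seq c1 c2 => wp w c1 (wp w c2 Q) st
  | If e c1 c2 => if eval w st e != 0 then wp w c1 Q st else wp w c2 Q st
  | While _ _ => False
  end.

Lemma wp_runs w c Q st : wp w c Q st -> runs w c st (cost c) Q.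
Proof.
elim: c Q st => [|i e|e1 e2|c1 IH1 c2 IH2|e c1 IH1 c2 IH2|//] Q st /=.
- by exists 1, st; split=> //; constructor.
- by eexists _, _; split; [constructor | |].
- by eexists _, _; split; [constructor | |].
- move=> /IH1[t1 [st1 [run1 le1 /IH2[t2 [st2 [run2 le2 Qst2]]]]]].
  by exists (t1 + t2), st2; split; [econstructor; eassumption | lia |].
- case: ifPn => [e1 /IH1|e0 /IH2] [t1 [st1 [run1 le1 Qst1]]];
    exists ((ecost e).+1 + t1), st1; split=> //; try lia; constructor.
  + by rewrite e1.
  + by rewrite (negbTE e0).
Qed.

Lemma runs_seq w c1 c2 st T1 T2 (Q1 Q : state -> Prop) :
  runs w c1 st T1 Q1 -> (forall st1, Q1 st1 -> runs w c2 st1 T2 Q) ->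
  runs w (Seq c1 c2) st (T1 + T2) Q.
Proof.
move=> [t1 [st1 [run1 le1 Qst1]]] /(_ _ Qst1)[t2 [st2 [run2 le2 Qst2]]].
by exists (t1 + t2), st2; split; [econstructor; eassumption | lia |].
Qed.

Lemma runs_weaken w c st T T' (Q Q' : state -> Prop) :
  T <= T' -> (forall st', Q st' -> Q' st') ->
  runs w c st T Q -> runs w c st T' Q'.
Proof.
move=> le_T QQ' [t [st' [run le Qst]]].
by exists t, st'; split; [|exact: leq_trans le_T | exact: QQ'].
Qed.

(** The index of the invariant only bounds the number of remaining iterations, as binary search
    requires; the loop may stop earlier. *)
Lemma runs_while w e c (I : nat -> state -> Prop) B k st :
    (forall k st, I k st -> eval w st e != 0 ->
       0 < k /\ runs w c st B (I k.-1)) ->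
    I k st ->
  runs w (While e c) st (k * ((ecost e).+1 + B) + (ecost e).+1)
    (fun st' => (exists k', I k' st') /\ eval w st' e = 0).
Proof.
move=> step; elim: k st => [|k IH] st Ist.
  have [e0|/(step _ _ Ist)[]//] := eqVneq (eval w st e) 0.
  exists (ecost e).+1, st; split=> //; first exact: exec_while_false.
  by split=> //; exists 0.
have [e0|ne0] := eqVneq (eval w st e) 0.
  exists (ecost e).+1, st; split; [exact: exec_while_false | lia |].
  by split=> //; exists k.+1.
have [_ [t1 [st1 [run1 le1 /IH[t2 [st2 [run2 le2 Qst2]]]]]]] := step _ _ Ist ne0.
exists ((ecost e).+1 + t1 + t2), st2; split=> //; last lia.
exact: exec_while_true run2.
Qed.

Lemma runs_for w e c (I : nat -> state -> Prop) n st :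
    (forall i st, i <= n -> I i st -> (eval w st e != 0) = (i < n)) ->
    (forall i st, i < n -> I i st -> wp w c (I i.+1) st) ->
    I 0 st ->
  runs w (While e c) st (n * ((ecost e).+1 + cost c) + (ecost e).+1) (I n).
Proof.
(* [J] counts the remaining iterations instead of those done. *)
move=> test step I0; pose J k st := k <= n /\ I (n - k) st.
have Jstep k st' : J k st' -> eval w st' e != 0 ->
    0 < k /\ runs w c st' (cost c) (J k.-1).
  move=> [le_k Ik]; rewrite (test _ _ _ Ik) ?leq_subr // => lt_k.
  split; first by lia.
  apply: runs_weaken (leqnn _) _ (wp_runs (step _ _ lt_k Ik)) => st''.
  have -> : (n - k).+1 = n - k.-1 by lia.
  by move=> Ik'; split=> //; lia.
have Jn : J n st by rewrite /J leqnn subnn.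
apply: runs_weaken (leqnn _) _ (runs_while Jstep Jn) => st' [[k [le_k Ik]] /eqP].
rewrite -[_ == 0]negbK (test _ _ _ Ik) ?leq_subr // => nlt.
by have -> : n = n - k by lia.
Qed.

Lemma wp_mono w c (Q Q' : state -> Prop) st :
  (forall st', Q st' -> Q' st') -> wp w c Q st -> wp w c Q' st.
Proof.
elim: c Q Q' st => [|i e|e1 e2|c1 IH1 c2 IH2|e c1 IH1 c2 IH2|//] Q Q' st QQ' /=;
  try exact: QQ'.
- by apply: IH1 => st'; apply: IH2.
- by case: ifP => _; [apply: IH1 | apply: IH2].
Qed.

(** Naming the state after a conditional joins its branches, so that the rest of the program is
    treated once. *)
Lemma wp_cut w c st st' Q :
  wp w c (fun st1 => st1 = st') st -> Q st' -> wp w c Q st.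
Proof. by move=> run Qst'; apply: wp_mono run => st1 ->. Qed.

Lemma wp_seq w c1 c2 Q st : wp w c1 (wp w c2 Q) st -> wp w (Seq c1 c2) Q st.
Proof. by []. Qed.

Lemma runs_if w e c1 c2 st T Q : eval w st e != 0 ->
  runs w c1 st T Q -> runs w (If e c1 c2) st ((ecost e).+1 + T) Q.
Proof.
move=> e1 [t [st' [run le_T Qst']]]; exists ((ecost e).+1 + t), st'; split=> //.
  by constructor; rewrite e1.
by rewrite leq_add2l.
Qed.

(** A branch that writes nothing can thus be described as an update, too. *)
Lemma upd_id f i : upd f i (f i) = f.
Proof. by apply: functional_extensionality => j; rewrite /upd; case: eqP => [->|]. Qed.

Lemma wp_assign w i e v Q st :
  eval w st e = v -> Q (State (upd (regs st) i v) (cells st)) ->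
  wp w (Assign i e) Q st.
Proof. by move=> <-. Qed.

Lemma wp_store w e1 e2 a v Q st :
  eval w st e1 = a -> eval w st e2 = v ->
  Q (State (regs st) (upd (cells st) a v)) -> wp w (Store e1 e2) Q st.
Proof. by move=> <- <-. Qed.

Lemma wp_if w e (b : bool) c1 c2 Q st :
  eval w st e = b -> (if b then wp w c1 Q st else wp w c2 Q st) ->
  wp w (If e c1 c2) Q st.
Proof. by move=> /= ->; case: b. Qed.

Lemma runs_wp_seq w c1 c2 st T (Q : state -> Prop) :
  wp w c1 (fun st1 => runs w c2 st1 T Q) st ->
  runs w (Seq c1 c2) st (cost c1 + T) Q.
Proof. by move=> /wp_runs run; apply: runs_seq run _. Qed.

Lemma runs_for_seq w e c (I : nat -> state -> Prop) n c2 st T Q :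
    (forall i st, i <= n -> I i st -> (eval w st e != 0) = (i < n)) ->
    (forall i st, i < n -> I i st -> wp w c (I i.+1) st) ->
    I 0 st ->
    (forall st, I n st -> runs w c2 st T Q) ->
  runs w (Seq (While e c) c2) st
    (n * ((ecost e).+1 + cost c) + (ecost e).+1 + T) Q.
Proof.
by move=> test step I0; apply: runs_seq; apply: runs_for.
Qed.

(** * The programs *)

Declare Scope ram_scope.
Delimit Scope ram_scope with ram.
Local Notation "x + y" := (Bin OpAdd x y) : ram_scope.
Local Notation "x - y" := (Bin OpSub x y) : ram_scope.
Local Notation "x * y" := (Bin OpMul x y) : ram_scope.
Local Notation "x %/ y" := (Bin OpDiv x y) : ram_scope.
Local Notation "x < y" := (Bin OpLt x y) : ram_scope.
Local Notation "x == y" := (Bin OpEq x y) : ram_scope.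
Local Notation "[ a ]" := (Defs.Mem a) : ram_scope.
Local Notation "$ i" := (Reg i) (at level 5, format "$ i") : ram_scope.
Local Notation "# k" := (Lit k) (at level 5, format "# k") : ram_scope.
Local Notation "i <- e" := (Assign i e) (at level 85) : ram_scope.
Local Notation "a <<- e" := (Store a e) (at level 85) : ram_scope.
Local Notation "c ;; d" := (Seq c d) (at level 90, right associativity) : ram_scope.
Local Open Scope ram_scope.

(** Cut 0 has counts 0, already in memory, so register 5 starts at 1. Thanks to the sentinel the end
    of [s] is recorded like any other cut. *)
Definition cuts_body : cmd :=
  If [$2] (4 <- $4 + #1) (3 <- $3 + #1) ;;
  If ([$2] == [$2 + #1]) Skip
    (($1 + $5) <<- $3 ;; (#2 * $1 + $5) <<- $4 ;; 5 <- $5 + #1) ;;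
  2 <- $2 + #1.

(** One loop over the pair code in register 6 replaces two nested ones; the code is decoded as in
    [vec]. *)
Definition table_body : cmd :=
  7 <- $6 %/ $5 ;; 8 <- $6 - $7 * $5 ;;
  9 <- [$1 + $8] - [$1 + $7] ;; 10 <- [#2 * $1 + $8] - [#2 * $1 + $7] ;;
  11 <- #3 * $1 + $9 ;; If ([$11] < $10) ($11 <<- $10) Skip ;;
  11 <- #4 * $1 + $9 ;; 10 <- $0 + #1 - $10 ;;
  If ([$11] < $10) ($11 <<- $10) Skip ;;
  6 <- $6 + #1.

(** Register 2 is one more than the argument whose cell is updated; cell n + 1 of the table needs no
    update. *)
Definition suffix_body : cmd :=
  11 <- #4 * $1 + $2 - #1 ;;
  If ([$11] < [$11 + #1]) ($11 <<- [$11 + #1]) Skip ;;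
  2 <- $2 - #1.

(** Registers 7 and 8 hold the previous values of [low] and [high]. The running maximum for [high]
    is formed here, and the product of the two tests is their conjunction. *)
Definition emit_body : cmd :=
  9 <- $0 + #1 - [#4 * $1 + $2] ;;
  10 <- $8 ;; If ($8 < [#3 * $1 + $2]) (10 <- [#3 * $1 + $2]) Skip ;;
  If (($9 == $7) * ($10 == $8)) Skip
    ($6 <<- $2 ;; ($6 + #1) <<- $9 ;; ($6 + #2) <<- $10 ;; ($6 + #3) <<- #0 ;;
     6 <- $6 + #4 ;; 5 <- $5 + #2) ;;
  7 <- $9 ;; 8 <- $10 ;; 2 <- $2 + #1.

(* Memory, with N = |s| + 2: s followed by the sentinel 2, then the prefix
   counts of a's and b's at the cuts from N and 2N on, the tables for [high] and
   [low] from 3N and 4N on, and the index from 5N on. *)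
Definition build_main : cmd :=
  (1 <- $0 + #2 ;; 5 <- #1 ;; $0 <<- #2) ;;
  While ($2 < $0) cuts_body ;;
  6 <- #0 ;;
  While ($6 < $5 * $5) table_body ;;
  2 <- $0 + #1 ;;
  While $2 suffix_body ;;
  (2 <- #0 ;; 6 <- #5 * $1 ;; 7 <- $1 ;; 8 <- #0 ;; 5 <- #0) ;;
  While ($2 < $1) emit_body ;;
  (0 <- $5 ;; 1 <- #5 * $1).

Definition build : cmd := If $0 build_main Skip.

Definition search_body : cmd :=
  5 <- ($3 + $4) %/ #2 ;; If ($1 < [#4 * $5]) (4 <- $5) (3 <- $5).

(** Registers 3 and 4 enclose the last breakpoint not above x. An empty index means an empty string,
    which matches only (0, 0). *)
Definition query : cmd :=
  If $0
    ((3 <- #0 ;; 4 <- $0 %/ #2) ;;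
     While (#1 < $4 - $3) search_body ;;
     0 <- (($2 < [#4 * $3 + #1]) + ([#4 * $3 + #2] < $2)) == #0)
    (0 <- ($1 == #0) * ($2 == #0)).

Local Close Scope ram_scope.

(** Innermost reductions go first, so that [lia] excludes overflow on plain naturals. *)
Ltac word := repeat match goal with |- context [?a %% 2 ^ ?w] =>
  lazymatch a with
  | context [_ %% 2 ^ w] => fail
  | _ => rewrite (@modn_small a (2 ^ w)); [|lia]
  end end.

(** * Correctness and running time of the construction *)

Definition cuts_inv (s : seq bool) (i : nat) (st : state) : Prop :=
  let n := size s in let (r, m) := st in
  [/\ r 0 = n, r 1 = n.+2 & r 2 = i] /\
  [/\ r 3 = cnt false s i, r 4 = cnt true s i & r 5 = size (pts s i)] /\
  [/\ forall j, j <= n -> m j = letter s j,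
      forall j, j < n.+2 -> m (n.+2 + j) = (nth (0, 0) (pts s i) j).1,
      forall j, j < n.+2 -> m (2 * n.+2 + j) = (nth (0, 0) (pts s i) j).2
    & forall j, 3 * n.+2 <= j -> m j = 0].

(** With N = n + 2, addresses stay within 9N and pair codes within N^2 throughout the construction,
    so 16 N^2 leaves room for every intermediate value. *)
Lemma cuts_step w s i st : 16 * ((size s).+2 * (size s).+2) <= 2 ^ w ->
  i < size s -> cuts_inv s i st -> wp w cuts_body (cuts_inv s i.+1) st.
Proof.
move=> HW lt_i; case: st => r m [[r0 r1 r2] [[r3 r4 r5] [m0 m1 m2 m3]]].
have lt_k := size_ptsS s i; set k := size (pts s i) in r5 lt_k.
have cntW c : cnt c s i <= i by have := @cnt_sum s i; case: c; lia.
have cntWf := cntW false; have cntWt := cntW true.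
have si : letter s i = nth true s i by rewrite /letter (nth_map true).
apply: wp_seq.
apply: (@wp_cut _ _ _ (State (upd (upd r 3 (cnt false s i.+1)) 4 (cnt true s i.+1)) m)).
  apply: (@wp_if _ _ (nth true s i)); first by rewrite /= r2 m0 // ltnW.
  rewrite !cntS // si; case: nth => /=; rewrite ?r3 ?r4; word.
    by rewrite addn0 -r3 upd_id.
  by rewrite addn0 -r4 -[r 4 in RHS]/(upd r 3 (cnt false s i + 1) 4) upd_id.
apply: wp_seq; apply: (@wp_if _ _ (letter s i == letter s i.+1)).
  by rewrite /= /upd /= r2; word; rewrite addn1 !m0 //; lia.
have -> : (letter s i == letter s i.+1) = ~~ run_end s i by rewrite negbK.
case end_i: (run_end s i) => /=; last first.
  rewrite /cuts_inv /upd /= r2 ptsS end_i; word; split; first by split=> //; lia.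
  by split.
rewrite /cuts_inv ptsS end_i size_rcons /upd /= r1 r2 r5; word.
split; [by split=> //; lia | split; [by split=> //; rewrite -/k addn1 | split=> j lt_j]].
- by rewrite !ifN_eq ?m0 //; lia.
- rewrite nth_rcons_upd eqn_add2l -/k ifN_eq; last by lia.
  by case: eqP => // _; apply: m1.
- rewrite eqn_add2l nth_rcons_upd -/k [X in if _ then _ else X]ifN_eq; last by lia.
  by case: eqP => // _; apply: m2.
by rewrite !ifN_eq ?m3 //; lia.
Qed.

Definition tables_inv (s : seq bool) (t : nat) (st : state) : Prop :=
  let n := size s in let (r, m) := st in
  [/\ r 0 = n, r 1 = n.+2, r 5 = (rho s).+1 & r 6 = t] /\
  [/\ forall j, j < n.+2 -> m (n.+2 + j) = (nth (0, 0) (pts s n) j).1,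
      forall j, j < n.+2 -> m (2 * n.+2 + j) = (nth (0, 0) (pts s n) j).2,
      forall x, x < n.+2 -> m (3 * n.+2 + x) = tab_high (vecs s t) x
    & forall x, x < n.+2 -> m (4 * n.+2 + x) = tab_low n (vecs s t) x].

Lemma wp_max w a v r m Q : 1 < 2 ^ w -> r 11 = a -> r 10 = v ->
  Q (State r (upd m a (maxn (m a) v))) ->
  wp w (If (Bin OpLt (Defs.Mem (Reg 11)) (Reg 10)) (Store (Reg 11) (Reg 10)) Skip)
     Q (State r m).
Proof.
move=> W1 <- <-; apply: wp_cut; apply: (@wp_if _ _ (m (r 11) < r 10)).
  by rewrite /=; word.
by case: ltnP => [lt|le] /=; rewrite ?upd_id.
Qed.

Lemma tables_step w s t st : 16 * ((size s).+2 * (size s).+2) <= 2 ^ w ->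
  t < (rho s).+1 * (rho s).+1 -> tables_inv s t st ->
  wp w table_body (tables_inv s t.+1) st.
Proof.
move=> HW lt_t; case: st => r m [[r0 r1 r5 r6] [m1 m2 m3 m4]].
have le_rho := rho_le s.
pose p := t %/ (rho s).+1; pose q := t %% (rho s).+1.
have lt_p : p < (rho s).+1 by rewrite ltn_divLR.
have lt_q : q < (rho s).+1 by rewrite ltn_mod.
have def_t : t = p * (rho s).+1 + q := divn_eq _ _.
have [le_A le_B] := vec_le s t.
have vec1 : (vec s t).1 = m ((size s).+2 + q) - m ((size s).+2 + p).
  by rewrite !m1 //; lia.
have vec2 : (vec s t).2 = m (2 * (size s).+2 + q) - m (2 * (size s).+2 + p).
  by rewrite !m2 //; lia.
have W1 : 1 < 2 ^ w by lia.
have lt_tW : t.+1 < 2 ^ w.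
  have : (rho s).+1 * (rho s).+1 <= (size s).+2 * (size s).+2.
    by apply: leq_mul; lia.
  by lia.
apply: wp_seq; apply: (@wp_assign _ _ _ p).
  by rewrite /= r6 r5; word.
apply: wp_seq; apply: (@wp_assign _ _ _ q).
  by rewrite /= /upd /= r6 r5; word; lia.
apply: wp_seq; apply: (@wp_assign _ _ _ (vec s t).1).
  by rewrite /= /upd /= r1; word; rewrite -vec1; word.
apply: wp_seq; apply: (@wp_assign _ _ _ (vec s t).2).
  by rewrite /= /upd /= r1; word; rewrite -vec2; word.
apply: wp_seq; apply: (@wp_assign _ _ _ (3 * (size s).+2 + (vec s t).1)).
  by rewrite /= /upd /= r1; word.
apply: wp_seq; apply: wp_max; [by [] | by [] | by [] |].
apply: wp_seq; apply: (@wp_assign _ _ _ (4 * (size s).+2 + (vec s t).1)).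
  by rewrite /= /upd /= r1; word.
apply: wp_seq; apply: (@wp_assign _ _ _ ((size s).+1 - (vec s t).2)).
  by rewrite /= /upd /= r0; word; rewrite addn1.
apply: wp_seq; apply: wp_max; [by [] | by [] | by [] |].
apply: (@wp_assign _ _ _ t.+1).
  by rewrite /= /upd /= r6; word; rewrite addn1.
split; first by split.
rewrite /upd /=; split=> j lt_j.
- by rewrite !ifN_eq ?m1 //; lia.
- by rewrite !ifN_eq ?m2 //; lia.
- rewrite ifN_eq ?eqn_add2l; last by lia.
  rewrite tab_highS !m3 //; last by lia.
  by case: eqP => [->|_]; rewrite ?maxn0.
rewrite eqn_add2l tab_lowS; case: eqP => [->|_].
  by rewrite ifN_eq ?m4 //; lia.
by rewrite maxn0 ifN_eq ?m4 //; lia.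
Qed.

Definition suffix_inv (s : seq bool) (k : nat) (st : state) : Prop :=
  let n := size s in let (r, m) := st in
  [/\ r 0 = n, r 1 = n.+2 & r 2 = n.+1 - k] /\
  [/\ forall x, x < n.+2 -> m (3 * n.+2 + x) = tab_high (all_vecs s) x,
      forall x, x < n.+1 - k -> m (4 * n.+2 + x) = tab_low n (all_vecs s) x
    & forall x, n.+1 - k <= x < n.+2 -> m (4 * n.+2 + x) = suf_low s x].

Lemma suffix_step w s k st : 16 * ((size s).+2 * (size s).+2) <= 2 ^ w ->
  k < (size s).+1 -> suffix_inv s k st -> wp w suffix_body (suffix_inv s k.+1) st.
Proof.
move=> HW lt_k; case: st => r m [[r0 r1 r2] [m1 m2 m3]].
pose x := (size s).+1 - k.+1.
have W1 : 1 < 2 ^ w by lia.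
apply: wp_seq; apply: (@wp_assign _ _ _ (4 * (size s).+2 + x)).
  by rewrite /= r1 r2; word; lia.
apply: wp_seq; apply: (@wp_cut _ _ _ (State (upd r 11 (4 * (size s).+2 + x))
    (upd m (4 * (size s).+2 + x) (suf_low s x)))).
  have def_x : suf_low s x = maxn (m (4 * (size s).+2 + x)) (m (4 * (size s).+2 + x.+1)).
    by rewrite suf_lowE m2 ?m3 //; lia.
  rewrite def_x.
  apply: (@wp_if _ _ (m (4 * (size s).+2 + x) < m (4 * (size s).+2 + x.+1))).
    by rewrite /= /upd /=; word; rewrite addn1 addnS.
  case: ltnP => _ /=; last by rewrite upd_id.
  by rewrite /upd /=; word; rewrite addn1 addnS.
apply: (@wp_assign _ _ _ x); first by rewrite /= /upd /= r2; word; lia.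
split; first by split.
rewrite /upd /=; split=> z lt_z.
- by rewrite ifN_eq ?m1 //; lia.
- by rewrite ifN_eq ?m2 //; lia.
by rewrite eqn_add2l; case: eqP => [->//|ne]; rewrite m3 //; lia.
Qed.

Definition emit_inv (s : seq bool) (x : nat) (st : state) : Prop :=
  let n := size s in let (r, m) := st in
  [/\ r 0 = n, r 1 = n.+2 & r 2 = x] /\
  [/\ r 5 = 2 * size (breakpoints s x), r 6 = 5 * n.+2 + size (emitted s x),
      r 7 = (prev_bounds s x).1 & r 8 = (prev_bounds s x).2] /\
  [/\ forall z, z < n.+2 -> m (3 * n.+2 + z) = tab_high (all_vecs s) z,
      forall z, z < n.+2 -> m (4 * n.+2 + z) = suf_low s z
    & forall i, i < size (emitted s x) ->
        m (5 * n.+2 + i) = nth 0 (emitted s x) i].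

Lemma emit_step w s x st : 16 * ((size s).+2 * (size s).+2) <= 2 ^ w ->
  x < (size s).+2 -> emit_inv s x st -> wp w emit_body (emit_inv s x.+1) st.
Proof.
move=> HW lt_x; case: st => r m [[r0 r1 r2] [[r5 r6 r7 r8] [m1 m2 m3]]].
have W1 : 1 < 2 ^ w by lia.
have := size_breakpoints s x; rewrite leq_min => /andP[le_bp _].
have le_em : size (emitted s x) <= 4 * x by rewrite size_emitted; lia.
have le_low := low_le s x; have le_high := high_le s x.
have [le_p1 le_p2] := prev_bounds_le s x.
apply: wp_seq; apply: (@wp_assign _ _ _ (low s x)).
  by rewrite /= r0 r1 r2; word; rewrite m2 // addn1; word.
apply: wp_seq; apply: (@wp_assign _ _ _ (prev_bounds s x).2); first by [].
apply: wp_seq; apply: (@wp_cut _ _ _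
    (State (upd (upd (upd r 9 (low s x)) 10 (prev_bounds s x).2) 10 (high s x)) m)).
  apply: (@wp_if _ _ ((prev_bounds s x).2 < tab_high (all_vecs s) x)).
    by rewrite /= /upd /= r1 r2 r8; word; rewrite m1 //; word.
  rewrite high_prev; case: ltnP => _ /=.
    by rewrite /upd /= r1 r2; word; rewrite m1.
  by rewrite (upd_id (upd (upd r 9 (low s x)) 10 (prev_bounds s x).2) 10).
apply: wp_seq; apply: (@wp_if _ _ (~~ breakpoint s x)).
  rewrite /= /upd /= r7 r8; word; rewrite mulnb /breakpoint negbK.
  by case: prev_bounds.
rewrite /emit_inv breakpointsS emittedS.
case: (breakpoint s x) => /=; last first.
  rewrite /upd /= r2 cats0; word; split; first by split=> //; lia.
  by split.
rewrite size_rcons size_cat /= /upd /= r2 r5 r6; word.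
split; first by split=> //; lia.
split; first by split=> //; lia.
split=> z lt_z.
- by rewrite !ifN_eq ?m1 //; lia.
- by rewrite !ifN_eq ?m2 //; lia.
rewrite nth_cat -!addnA !eqn_add2l.
case: ltnP => [lt_z' | le_z].
  by rewrite !ifN_eq ?m3 //; lia.
have : z - size (emitted s x) < 4 by lia.
rewrite -{1 2 3 4 5 6}(subnKC le_z); move: (z - _) => k.
rewrite !eqn_add2l.
by case: k => [|[|[|[|k]]]] //=; rewrite ?addn0 ?eqxx //; lia.
Qed.

Lemma build_main_runs w (s : seq bool) : s != [::] ->
  16 * ((size s).+2 * (size s).+2) <= 2 ^ w ->
  exists2 T, T <= 300 * (size s + (rho s).+1 * (rho s).+1 + 1)
  & runs w build_main (init [:: size s] (map nat_of_bool s)) T (fun st =>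
     regs st 0 = size (index_of s) /\
     forall i, i < size (words (index_of s)) ->
       cells st (regs st 1 + i) = nth 0 (words (index_of s)) i).
Proof.
move=> s0 HW; have W1 : 1 < 2 ^ w by lia.
have le_rho := rho_le s.
have lt_KW : (rho s).+1 * (rho s).+1 < 2 ^ w.
  have : (rho s).+1 * (rho s).+1 <= (size s).+2 * (size s).+2.
    by apply: leq_mul; lia.
  by lia.
(* The running time is left open, assembled by the sequencing rules and bounded at the end. *)
eexists; last first.
  rewrite /build_main /=.
  apply: runs_wp_seq.
  apply: wp_seq; apply: (@wp_assign _ _ _ (size s).+2).
    by rewrite /=; word; rewrite addn2.
  apply: wp_seq; apply: (@wp_assign _ _ _ 1); first by rewrite /=; word.
  apply: (@wp_store _ _ _ (size s) 2); [by []| by rewrite /=; word|].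
  apply: (@runs_for_seq w _ _ (cuts_inv s) (size s)).
  - by move=> i [r m] le_i [[r0 r1 r2] _]; rewrite /= r0 r2; word; case: ltnP.
  - by move=> i st lt_i; apply: cuts_step.
  - split; first by split.
    split; first by rewrite pts0 !cnt0; split.
    split=> j le_j; rewrite /upd /=.
    + case: eqP => [->|ne].
        by rewrite /letter nth_default ?size_map.
      by apply: set_nth_default; rewrite size_map; lia.
    + rewrite pts0 ifN_eq; last by lia.
      by rewrite nth_default ?size_map; [case: j {le_j} => [|[]] | lia].
    + rewrite pts0 ifN_eq; last by lia.
      by rewrite nth_default ?size_map; [case: j {le_j} => [|[]] | lia].
    by rewrite ifN_eq ?nth_default ?size_map; lia.
  move=> [r m] [[r0 r1 r2] [[r3 r4 r5] [m0 m1 m2 m3]]].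
  apply: runs_wp_seq; apply: (@wp_assign _ _ _ 0); first by rewrite /=; word.
  apply: (@runs_for_seq w _ _ (tables_inv s) ((rho s).+1 * (rho s).+1)).
  - move=> i [r' m'] le_i [[r'0 r'1 r'5 r'6] _].
    by rewrite /= r'5 r'6; word; case: ltnP.
  - by move=> i st lt_i; apply: tables_step.
  - rewrite size_pts in r5.
    split; first by split.
    by split=> // x lt_x; rewrite /= m3 ?vecs0 /tab_high /tab_low ?big_nil //; lia.
  move=> [r' m'] [[r'0 r'1 r'5 r'6] [_ _ m'3 m'4]].
  apply: runs_wp_seq; apply: (@wp_assign _ _ _ (size s).+1).
    by rewrite /= r'0; word; rewrite addn1.
  apply: (@runs_for_seq w _ _ (suffix_inv s) (size s).+1).
  - by move=> i [r2' m2'] le_i [[_ _ e2] _]; rewrite /= e2; lia.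
  - by move=> i st lt_i; apply: suffix_step.
  - split; first by split; rewrite ?subn0.
    split=> x lt_x; rewrite /= ?m'3 ?m'4 //; try lia.
    (* No vector has more than n a's, so the last cell is its own suffix maximum. *)
    have -> : x = (size s).+1 by lia.
    by rewrite suf_lowE (@suf_low_out _ (size s).+2) // maxn0.
  move=> {r m r' m' r0 r1 r2 r3 r4 r5 m0 m1 m2 m3 r'0 r'1 r'5 r'6 m'3 m'4}.
  move=> [r m] [[r0 r1 r2] [m1 _ m2]]; rewrite subnn in m2.
  apply: runs_wp_seq.
  apply: wp_seq; apply: (@wp_assign _ _ _ 0); first by rewrite /=; word.
  apply: wp_seq; apply: (@wp_assign _ _ _ (5 * (size s).+2)).
    by rewrite /= /upd /= r1; word.
  (* This is the first component of [prev_bounds s 0]. *)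
  apply: wp_seq; apply: (@wp_assign _ _ _ (size s).+2).
    by rewrite /= /upd /= r1.
  apply: wp_seq; apply: (@wp_assign _ _ _ 0); first by rewrite /=; word.
  apply: (@wp_assign _ _ _ 0); first by rewrite /=; word.
  apply: (@runs_for_seq w _ _ (emit_inv s) (size s).+2).
  - by move=> i [r' m'] le_i [[_ r'1 r'2] _]; rewrite /= r'1 r'2; word; case: ltnP.
  - by move=> i st lt_i; apply: emit_step.
  - split; first by split.
    split; first by rewrite /= /upd /= emitted0 addn0; split.
    by split=> //; rewrite emitted0.
  move=> {r m r0 r1 r2 m1 m2} [r m] [[r0 r1 _] [[r5 _ _ _] [_ _ m3]]].
  apply: wp_runs.
  apply: wp_seq; apply: wp_assign erefl _; apply: (@wp_assign _ _ _ (5 * (size s).+2)).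
    by rewrite /= /upd /= r1; word.
  rewrite /= /upd /= r5 /index_of (negbTE s0) size_flatten_entries.
  by split.
have := rho_gt0 s0; rewrite [cost]lock /= -lock /=; lia.
Qed.

(** * Correctness and running time of the binary search *)

Definition search_inv (s : seq bool) (x y k : nat) (st : state) : Prop :=
  let zs := breakpoints s (size s).+2 in let (r, m) := st in
  [/\ r 1 = x, r 2 = y & m = nth 0 (words (index_of s))] /\
  [/\ r 3 < r 4, r 4 <= size zs & r 4 - r 3 <= 2 ^ k] /\
  (nth 0 zs (r 3) <= x /\ (r 4 < size zs -> x < nth 0 zs (r 4))).

(** The right end [size zs] acts as plus infinity. A gap of at least 2 forces k > 0; then 2^k is
    even, so even the larger half is at most 2^(k-1). *)
Lemma search_step w (s : seq bool) x y k st : s != [::] ->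
    16 * ((size s).+2 * (size s).+2) <= 2 ^ w ->
    search_inv s x y k st ->
    eval w st (Bin OpLt (Lit 1) (Bin OpSub (Reg 4) (Reg 3))) != 0 ->
  0 < k /\ runs w search_body st (cost search_body) (search_inv s x y k.-1).
Proof.
move=> s0 HW; case: st => r m [[r1 r2 ->] [[lt34 le4 le_k] [le_x lt_x]]].
have W1 : 1 < 2 ^ w by lia.
set zs := breakpoints s (size s).+2 in le4 le_x lt_x *.
have le_zs : size zs <= (size s).+2.
  by have := size_breakpoints s (size s).+2; rewrite leq_min => /andP[].
rewrite /=; word; rewrite eqb0 negbK => gap.
have k_gt0 : 0 < k by case: k le_k => //=; lia.
split=> //; apply: wp_runs.
pose mid := (r 3 + r 4) %/ 2.
have [lt3 lt4] : r 3 < mid /\ mid < r 4 by rewrite /mid; lia.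
have [z_mid _ _] := @nth_words_entries s zs mid (leq_trans lt4 le4).
have le_k' : r 4 - mid <= 2 ^ k.-1 /\ mid - r 3 <= 2 ^ k.-1.
  move: le_k; rewrite -{1}(prednK k_gt0) expnS /mid; lia.
apply: wp_seq; apply: (@wp_assign _ _ _ mid); first by rewrite /=; word.
apply: (@wp_if _ _ (x < nth 0 zs mid)).
  by rewrite /= /upd /= r1; word; rewrite /index_of (negbTE s0) z_mid.
case: ltnP => cmp; rewrite /= /upd /=; (split; first by split);
  by split; split=> //; rewrite -/zs; lia.
Qed.

Lemma query_runs w (s : seq bool) x y k : s != [::] ->
    16 * ((size s).+2 * (size s).+2) <= 2 ^ w ->
    size (breakpoints s (size s).+2) <= 2 ^ k ->
  answers w query (index_of s) x y (jumbled_match s x y) (100 * k.+1).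
Proof.
move=> s0 HW le_k; have W1 : 1 < 2 ^ w by lia.
have le_zs : size (breakpoints s (size s).+2) <= (size s).+2.
  by have := size_breakpoints s (size s).+2; rewrite leq_min => /andP[].
have def_idx : index_of s = flatten [seq entries s z | z <- breakpoints s (size s).+2].
  by rewrite /index_of (negbTE s0).
have sz_idx : size (index_of s) = 2 * size (breakpoints s (size s).+2).
  by rewrite def_idx size_flatten_entries.
have [z0 zs_gt0] := nth0_breakpoints s (size s).+1.
set zs := breakpoints s (size s).+2 in le_k le_zs def_idx sz_idx z0 zs_gt0.
have I0 : search_inv s x y k
   (State (upd (upd (nth 0 [:: size (index_of s); x; y]) 3 0) 4 (size zs))
      (nth 0 (words (index_of s)))).
  by split; split; rewrite /upd /= ?subn0 ?z0 ?ltnn.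
suff [T le_T [t [st [run le_t ans]]]] : exists2 T, T <= 100 * k.+1 & runs w query
    (init [:: size (index_of s); x; y] (words (index_of s))) T
    (fun st => regs st 0 = (low s x <= y <= high s x)).
  exists t, st; split=> //; first exact: leq_trans le_T.
  by rewrite ans eqb0 negbK; apply: iff_sym; apply: jumbled_matchE.
eexists; last first.
  apply: runs_if; first by rewrite /= sz_idx; lia.
  apply: runs_wp_seq; apply: wp_seq; apply: (@wp_assign _ _ _ 0).
    by rewrite /=; word.
  apply: (@wp_assign _ _ _ (size zs)); first by rewrite /= /upd /= sz_idx; word; lia.
  apply: (runs_seq (runs_while (fun k st => @search_step w s x y k st s0 HW) I0)).
  move=> [r m] [[k' [[r1 r2 ->] [[lt34 le4 _] [le_x lt_x]]]] e0].
  rewrite -/zs in le4 le_x lt_x.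
  have gap : r 4 = (r 3).+1.
    by move: e0; rewrite /=; word; lia.
  rewrite gap in le4 lt_x.
  have [z_lo z_hi] := bounds_nth_breakpoints le4 le_x lt_x.
  have [_ c1 c2] := @nth_words_entries s zs (r 3) le4.
  rewrite -def_idx -z_lo -z_hi in c1 c2.
  have le_low := low_le s x; have le_high := high_le s x.
  apply: wp_runs; apply: wp_assign erefl _.
  rewrite /= /upd /= r2; word; rewrite c1 c2.
  by case: ltnP; case: ltnP => * /=; word; lia.
rewrite [cost]lock /= -lock /=; lia.
Qed.

(** * The empty string and the final bounds *)

Lemma jumbled_match_nil x y : jumbled_match [::] x y <-> (x == 0) && (y == 0).
Proof.
split=> [[t [+ <- <-]]|/andP[/eqP-> /eqP->]]; first by rewrite infixs0 => /eqP->.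
by exists [::].
Qed.

Theorem theorem1 :
  exists (build query : cmd) (C c : nat),
  forall s : seq bool,
  exists idx : seq (nat * nat),
    [/\ size idx <= C * minn (rho s ^ 2) (size s),
        forall w : nat, (size s).+2 ^ c <= 2 ^ w ->
          builds w build s idx
            (C * (size s + rho s ^ 2 * trunc_log 2 (rho s) + 1))
      & forall w x y : nat,
          (size s).+2 ^ c <= 2 ^ w -> x < 2 ^ w -> y < 2 ^ w ->
          answers w query idx x y (jumbled_match s x y)
            (C * (trunc_log 2 (rho s) + 1))].
Proof.
(* Exponent 6 suffices since N = n + 2 >= 2 gives 16 N^2 <= N^6; 2000 absorbs all constants below
   with slack. *)
exists build, query, 2000, 6 => s; exists (index_of s).
have large w : (size s).+2 ^ 6 <= 2 ^ w -> 16 * ((size s).+2 * (size s).+2) <= 2 ^ w.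
  apply: leq_trans; rewrite mulnn (expnD _ 4 2) leq_mul2r; apply/orP; right.
  by rewrite (@leq_exp2r 2 _ 4).
split.
- by apply: leq_trans (size_index_of s) _; rewrite leq_mul2r orbT.
- move=> w /large HW; have [s_nil|s0] := eqVneq s [::].
    rewrite s_nil; exists 3, (init [:: 0] [::]); split=> //.
    by apply: (@exec_if _ _ _ _ _ 1); constructor.
  have [T le_T run] := build_main_runs s0 HW.
  have [|t [st [run' le_t [sz_idx idx]]]] := @runs_if w (Reg 0) _ Skip _ _ _ _ run.
    by rewrite /= -lt0n lt0n size_eq0.
  exists t, st; split=> //; apply: leq_trans le_t _.
  apply: (@leq_trans (302 * (size s + (rho s).+1 * (rho s).+1 + 1))).
    by rewrite /=; lia.
  have := rho_gt0 s0; rewrite -mulnn.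
  (* For rho = 1 the logarithm is 0 and the construction costs O(n + 1); otherwise it is at least 1
     and rho^2 is absorbed by rho^2 log rho. *)
  have [le1 rho_gt0|lt1 _] := leqP (rho s) 1.
    have -> : rho s = 1 by lia.
    by rewrite /=; lia.
  have log_gt0 : 0 < trunc_log 2 (rho s) by rewrite trunc_log_gt0.
  have : rho s * rho s <= rho s * rho s * trunc_log 2 (rho s).
    by rewrite leq_pmulr.
  by nia.
move=> w x y /large HW lt_x lt_y; have [s_nil|s0] := eqVneq s [::].
  have [t [st [run le_t ans]]] : runs w query (init [:: 0; x; y] [::]) 20
      (fun st => regs st 0 = (x == 0) && (y == 0)).
    eexists _, _; split; first by apply: exec_if; constructor.
      by [].
    by rewrite /= /upd /= mod0n; word; rewrite mulnb.
  rewrite s_nil; exists t, st; split=> //; first by apply: leq_trans le_t _; lia.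
  by rewrite ans eqb0 negbK; apply: iff_sym; apply: jumbled_match_nil.
have rho_pos := rho_gt0 s0.
have lt_rho : rho s < 2 ^ (trunc_log 2 (rho s)).+1 by apply: trunc_log_ltn.
(* With X = 2^(log rho + 1) >= rho + 1, the number of breakpoints is at most 1 + 2 X^2 <= 16 X^2. *)
have le_k : size (breakpoints s (size s).+2) <= 2 ^ (2 * trunc_log 2 (rho s) + 6).
  have := size_breakpoints s (size s).+2; rewrite leq_min => /andP[_ le_rho].
  have -> : 2 * trunc_log 2 (rho s) + 6
    = (trunc_log 2 (rho s)).+1 + (trunc_log 2 (rho s)).+1 + 4 by lia.
  rewrite !expnD; move: le_rho lt_rho; move: (2 ^ _.+1) => X; rewrite -mulnn.
  by nia.
have [t [st [run le_t ans]]] := query_runs x y s0 HW le_k.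
exists t, st; split=> //; apply: leq_trans le_t _; lia.
Qed.
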